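(* Let $K$ be a field and let $G$ be a finite simple graph without isolated vertices and with $E_G\neq\emptyset$. Let $e\in E_G$ and let $\prec$ be a grevlex order on $K[E_G]$ with $t_e$ last. Let $$\vartheta\colon\mathcal{B}_\prec(I(X_G),t_e)\to\mathcal{E}(V_G)\times(\mathbb{Z}/2),\qquad \mathbf{t}^\alpha\mapsto(\theta(\mathbf{t}^\alpha),\deg(\mathbf{t}^\alpha)+2\mathbb{Z}).$$ Then $\vartheta$ is injective and $$\operatorname{Im}\vartheta=\{(T,i)\in\mathcal{E}(V_G)\times(\mathbb{Z}/2) : \mathcal{J}_i(G,T)\neq\emptyset\text{ and }\tau_{i+1}(G,T\triangle e)=\tau_i(G,T)+1\}.$$
   Context: $G$ has vertex set $V_G$ and edge set $E_G$, a non-empty set of $2$-element subsets of $V_G$. Put $K[V_G]=K[x_i : i\in V_G]$ and $K[E_G]=K[t_h : h\in E_G]$. Let $\varphi\colon K[E_G]\to K[V_G]$ be the $K$-algebra homomorphism with $\varphi(t_h)=x_ix_j$ for $h=\{i,j\}\in E_G$. The Eulerian ideal of $G$ is $I(X_G)=\varphi^{-1}\big((x_i^2-x_j^2 : i,j\in V_G)\big)\subset K[E_G]$, and $(I(X_G),t_e)$ is the ideal generated by $I(X_G)$ and $t_e$. A grevlex order on $K[E_G]$ with $t_e$ last is the graded reverse lexicographic order induced by $t_{\epsilon(1)}\succ\cdots\succ t_{\epsilon(s)}$, where $s=|E_G|$ and $\epsilon\colon\{1,\dots,s\}\to E_G$ is a bijection with $\epsilon(s)=e$. For an ideal $I$,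 $\mathcal{B}_\prec(I)$ is the set of standard monomials of $I$, i.e. monomials not in the initial ideal $\operatorname{in}_\prec(I)$. For $\alpha\colon E_G\to\mathbb{N}$, write $\mathbf{t}^\alpha=\prod_{h\in E_G}t_h^{\alpha(h)}$ and $\mathcal{J}(\mathbf{t}^\alpha)=\{h\in E_G : \alpha(h)\text{ is odd}\}$; $\theta(\mathbf{t}^\alpha)$ is the set of odd degree vertices of the subgraph of $G$ edge-induced by $\mathcal{J}(\mathbf{t}^\alpha)$. $\mathcal{E}(V_G)$ is the set of even subsets of vertices: subsets $T\subset V_G$ such that $|T\cap V_H|$ is even for every connected component $H$ of $G$. A $T$-join is a subset $J\subset E_G$ such that $T$ is precisely the set of odd degree vertices of the subgraph edge-induced by $J$. For $T\in\mathcal{E}(V_G)$ and $i\in\mathbb{Z}/2$, $\mathcal{J}_i(G,T)$ is the set of $T$-joins $J$ with $|J|+2\mathbb{Z}=i$, and $\tau_i(G,T)$ is the minimum cardinality of an element of $\mathcal{J}_i(G,T)$, defined only when $\mathcal{J}_i(G,T)\neq\emptyset$. $\triangle$ denotes symmetric difference, and in $T\triangle e$ the edge $e=\{a,b\}$ is regarded as a $2$-element set of vertices (so $T\triangle e\in\mathcal{E}(V_G)$; moreover $\mathcal{J}_i(G,T)\neq\emptyset$ implies $\mathcal{J}_{i+1}(G,T\triangle e)\neq\emptyset$, so the condition makes sense). *)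

(* Defs.v *)
From mathcomp Require Import all_boot all_order all_algebra.
From mathcomp Require Import mpoly.

Set Implicit Arguments.
Unset Strict Implicit.
Unset Printing Implicit Defensive.

Import GRing.Theory.
Local Open Scope ring_scope.

(** * Ideals, monomial orders, standard monomials *)

Definition ideal_gen (R : comNzRingType) (S : R -> Prop) (p : R) : Prop :=
  exists s : seq (R * R),
    (forall c, c \in s -> S c.2) /\ p = \sum_(c <- s) c.1 * c.2.

Section InitialIdeal.
Variables (K : fieldType) (n : nat) (prec : rel 'X_{1..n}).

(* [prec] is a strict monomial order; zero has no leading monomial. *)
Definition is_lead (p : {mpoly K[n]}) (m : 'X_{1..n}) : Prop :=
  m \in msupp p /\ forall m', m' \in msupp p -> m' != m -> prec m' m.

Definition initial_ideal (I : {mpoly K[n]} -> Prop) : {mpoly K[n]} -> Prop :=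
  ideal_gen (fun q => exists p m, [/\ I p, is_lead p m & q = 'X_[m]]).

Definition standard (I : {mpoly K[n]} -> Prop) (m : 'X_{1..n}) : Prop :=
  ~ initial_ideal I 'X_[m].

End InitialIdeal.

(** * Graphs *)

Notation edge E := {h | h \in E}.

Section Graph.
Variables (V : finType) (E : {set {set V}}).

Definition simple_graph : Prop := forall h, h \in E -> #|h| = 2%N.

Definition no_isolated_vertex : Prop := forall v, exists2 h, h \in E & v \in h.

Definition nedges := #|{: edge E}|.

(* Over a simple graph (all edges have two elements) this is irreflexive. *)
Definition adj : rel V := fun u v => [set u; v] \in E.

Definition components : {set {set V}} :=
  equivalence_partition (connect adj) [set: V].

Definition even_subsets : {set {set V}} :=
  [set T | [forall C in components, ~~ odd #|T :&: C|]].

(* Vertices outside the subgraph edge-induced by [J] are counted with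
   degree 0, hence never belong to this set. *)
Definition odd_vertices (J : {set edge E}) : {set V} :=
  [set v | odd #|[set h in J | v \in val h]|].

Definition Tjoins (i : 'Z_2) (T : {set V}) : {set {set edge E}} :=
  [set J | (odd_vertices J == T) && (#|J|%:R == i)].

(* The default value [nedges] bounds every [#|J|], so this is the minimum
   cardinality whenever [Tjoins i T] is non-empty; it is meaningless
   otherwise. *)
Definition tau (i : 'Z_2) (T : {set V}) : nat :=
  \big[minn/nedges]_(J in Tjoins i T) #|J|.

(* The indeterminates of K[V_G] and K[E_G] are numbered by [enum_rank], so
   the exponent of t_h in a monomial [m] is [m (enum_rank h)]. *)

(* [m1] is strictly smaller than [m2] for the graded reverse lexicographic
   order with t_(eps 0) > t_(eps 1) > ... *)
Definition grevlex (eps : 'I_nedges -> edge E) : rel 'X_{1..nedges} :=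
  fun m1 m2 =>
    (mdeg m1 < mdeg m2)%N ||
    (mdeg m1 == mdeg m2) &&
    [exists k : 'I_nedges,
       (m2 (enum_rank (eps k)) < m1 (enum_rank (eps k)))%N &&
       [forall l : 'I_nedges,
          (k < l)%N ==> (m1 (enum_rank (eps l)) == m2 (enum_rank (eps l)))]].

Definition odd_support (m : 'X_{1..nedges}) : {set edge E} :=
  [set h | odd (m (enum_rank h))].

Definition vartheta (m : 'X_{1..nedges}) : {set V} * 'Z_2 :=
  (odd_vertices (odd_support m), (mdeg m)%:R).

Variable K : fieldType.

Definition xvar (v : V) : {mpoly K[#|V|]} := 'X_(enum_rank v).
Definition tvar (h : edge E) : {mpoly K[nedges]} := 'X_(enum_rank h).

Definition phi (p : {mpoly K[nedges]}) : {mpoly K[#|V|]} :=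
  comp_mpoly [tuple \prod_(v in val (enum_val k)) xvar v | k < nedges] p.

Definition eulerian_ideal (p : {mpoly K[nedges]}) : Prop :=
  ideal_gen (fun q => exists i j, q = xvar i ^+ 2 - xvar j ^+ 2) (phi p).

Definition eulerian_ideal_with (e : edge E) : {mpoly K[nedges]} -> Prop :=
  ideal_gen (fun q => eulerian_ideal q \/ q = tvar e).

End Graph.

Definition symdiff (V : finType) (A B : {set V}) : {set V} :=
  (A :\: B) :|: (B :\: A).

Arguments eulerian_ideal_with {V E} K e _.

(* Main.v *)
(** Modulo the differences of squares, two monomials of K[V_G] agree iff they
    have the same degree and the same exponent parities. Hence I(X_G) consists of
    the polynomials whose coefficients sum to zero over each class of monomials
    with fixed (theta, degree), and a monomial is standard for (I(X_G), t_e) iff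
    it is minimal in its class and no member of the class is divisible by t_e.
    The class (T, d) is non-empty iff d has parity i and d >= tau_i(T); it has a
    member divisible by t_e iff (T + e, d - 1) is non-empty. As tau_{i+1}(T + e)
    differs from tau_i(T) by exactly one, a standard monomial above (T, i) exists
    iff tau_{i+1}(T + e) = tau_i(T) + 1, and then its degree must be tau_i(T). *)

Require Import Defs.
From mathcomp Require Import all_boot all_order all_algebra.
From mathcomp Require Import mpoly.
From mathcomp Require Import zify.

Local Open Scope ring_scope.

Set Implicit Arguments.
Unset Strict Implicit.
Unset Printing Implicit Defensive.
Import Order.TTheory GRing.Theory.

(** * Congruences modulo an ideal given by generators *)

Section Ideals.
Variables (R : comNzRingType) (S : R -> Prop).

Lemma ideal_gen_sub p : S p -> ideal_gen S p.
Proof.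
move=> Sp; exists [:: (1, p)]; rewrite big_seq1 mul1r; split=> // c.
by rewrite inE => /eqP->.
Qed.

Lemma ideal_gen0 : ideal_gen S 0.
Proof. by exists [::]; rewrite big_nil. Qed.

Lemma ideal_genD p q : ideal_gen S p -> ideal_gen S q -> ideal_gen S (p + q).
Proof.
move=> [s [Ss ->]] [t [St ->]]; exists (s ++ t); rewrite big_cat; split=> // c.
by rewrite mem_cat => /orP[/Ss | /St].
Qed.

Lemma ideal_genM r p : ideal_gen S p -> ideal_gen S (r * p).
Proof.
move=> [s [Ss ->]]; exists [seq (r * c.1, c.2) | c <- s]; split.
  by move=> _ /mapP[c cs ->]; apply: (Ss c).
by rewrite big_map mulr_sumr; apply: eq_bigr => c _; rewrite mulrA.
Qed.

Lemma ideal_gen_congM a b c d :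
  ideal_gen S (a - b) -> ideal_gen S (c - d) -> ideal_gen S (a * c - b * d).
Proof.
move=> Iab Icd; rewrite (_ : _ - _ = c * (a - b) + b * (c - d)).
  by apply: ideal_genD; apply: ideal_genM.
by rewrite !mulrBr [c * a]mulrC [c * b]mulrC addrA subrK.
Qed.

Lemma ideal_gen_congX a b k :
  ideal_gen S (a - b) -> ideal_gen S (a ^+ k - b ^+ k).
Proof. by rewrite subrXX mulrC; apply: ideal_genM. Qed.

End Ideals.

(** * Sums of coefficients over a class of monomials *)

Section CoefficientSum.
Variables (K : fieldType) (n : nat) (P : pred 'X_{1..n}).
Implicit Types p q : {mpoly K[n]}.

Definition coef_sum p : K := \sum_(m <- msupp p | P m) p@_m.

(** Polynomials have different supports; a common degree bound supplies one index set on which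
    linearity can be checked termwise. *)
Lemma coef_sumwE k p : (msize p <= k)%N ->
  coef_sum p = \sum_(m : 'X_{1..n < k} | P m) p@_m.
Proof.
move=> le_pk; pose I : subFinType _ := 'X_{1..n < k}.
rewrite /coef_sum (ssrcomplements.big_mksub_cond I) ?msupp_uniq //=.
  by rewrite big_mkcondr; apply: eq_bigr => m _; case: ifPn => // /memN_msupp_eq0.
by move=> m /msize_mdeg_lt/leq_trans->.
Qed.

Lemma coef_sumP a p q : coef_sum (a *: p + q) = a * coef_sum p + coef_sum q.
Proof.
pose k := maxn (msize p) (maxn (msize q) (msize (a *: p + q))).
rewrite !(@coef_sumwE k) ?leq_max ?leqnn ?orbT //.
rewrite mulr_sumr -big_split; apply: eq_bigr => m _ /=.
by rewrite mcoeffD mcoeffZ.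
Qed.

Lemma coef_sum0 : coef_sum 0 = 0.
Proof. by rewrite /coef_sum msupp0 big_nil. Qed.

Lemma coef_sum_big I (r : seq I) (a : I -> K) (F : I -> {mpoly K[n]}) :
  coef_sum (\sum_(i <- r) a i *: F i) = \sum_(i <- r) a i * coef_sum (F i).
Proof.
elim: r => [|i r IHr]; first by rewrite !big_nil coef_sum0.
by rewrite !big_cons coef_sumP IHr.
Qed.

Lemma coef_sumB p q : coef_sum (p - q) = coef_sum p - coef_sum q.
Proof. by rewrite addrC -scaleN1r coef_sumP mulN1r addrC. Qed.

Lemma coef_sumD p q : coef_sum (p + q) = coef_sum p + coef_sum q.
Proof. by rewrite -[p in LHS]scale1r coef_sumP mul1r. Qed.

Lemma coef_sumX m : coef_sum 'X_[m] = (P m)%:R.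
Proof.
by rewrite /coef_sum msuppX big_mkcond big_seq1 mcoeffX eqxx; case: (P m).
Qed.

(** Used with [q] a generator of an ideal: its multiples reduce to monomial multiples, whose
    coefficient sums are explicit. *)
Lemma coef_sumME p q :
  coef_sum (p * q) = \sum_(m <- msupp p) p@_m * coef_sum ('X_[m] * q).
Proof.
rewrite {1}[p]mpolyE mulr_suml -coef_sum_big; congr coef_sum.
by apply: eq_bigr => m _; rewrite scalerAl.
Qed.

End CoefficientSum.


(** * Parity classes and the ideal of differences of squares *)

Definition same_parity n (a b : 'X_{1..n}) : bool :=
  (mdeg a == mdeg b) && [forall i, odd (a i) == odd (b i)].

Lemma same_parityP n (a b : 'X_{1..n}) :
  reflect (mdeg a = mdeg b /\ forall i, odd (a i) = odd (b i)) (same_parity a b).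
Proof.
apply: (iffP andP) => -[ab_deg ab_odd]; split.
- exact/eqP.
- by move=> i; apply/eqP; apply: (forallP ab_odd).
- exact/eqP.
- by apply/forallP => i; apply/eqP.
Qed.

Lemma same_parity_refl n : reflexive (@same_parity n).
Proof. by move=> a; apply/same_parityP. Qed.

Lemma same_parity_sym n : ssrbool.symmetric (@same_parity n).
Proof.
by move=> a b; rewrite /same_parity eq_sym; under eq_forallb do rewrite eq_sym.
Qed.

Lemma same_parity_trans n : transitive (@same_parity n).
Proof.
move=> b a c /same_parityP[ab ab'] /same_parityP[bc bc']; apply/same_parityP.
by split=> [|i]; [rewrite ab | rewrite ab'].
Qed.

Lemma same_parityD n (a b c : 'X_{1..n}) :
  same_parity a b -> same_parity (a + c)%MM (b + c)%MM.
Proof.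
move=> /same_parityP[ab ab']; apply/same_parityP.
by split=> [|i]; rewrite ?mdegD ?ab // !mnmDE !oddD ab'.
Qed.

Section SquareIdeal.
Variables (K : fieldType) (V : finType).
Implicit Types (p : {mpoly K[#|V|]}) (a b : 'X_{1..#|V|}).

Let sq_ideal p := ideal_gen (fun q => exists i j : V,
  q = xvar K i ^+ 2 - xvar K j ^+ 2) p.

(** The two terms of a monomial multiple of x_i^2 - x_j^2 lie in the same parity class, so their
    coefficients cancel in every class sum. *)
Lemma coef_sum_sq_ideal a p : sq_ideal p -> coef_sum (same_parity a) p = 0.
Proof.
move=> [s [Ss ->]]; elim: s Ss => [|c s IHs] Ss.
  by rewrite big_nil coef_sum0.
rewrite big_cons coef_sumD IHs ?addr0; last first.
  by move=> d ds; apply: Ss; rewrite inE ds orbT.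
have [i [j ->]] := Ss c (mem_head _ _).
rewrite coef_sumME big1_seq // => m _.
rewrite mulrBr coef_sumB !mpolyXn -!mpolyXD !coef_sumX.
set u := (m + _)%MM; set v := (m + _)%MM.
suff uv : same_parity u v.
  suff -> : same_parity a u = same_parity a v by rewrite subrr mulr0.
  apply/idP/idP => /same_parity_trans; apply=> //.
  by rewrite same_parity_sym.
apply/same_parityP; split=> [|k]; first by rewrite !(mdegD m) !mdegMn !mdeg1.
by rewrite !(mnmDE _ m) !mulmnE !oddD !oddM !andbF.
Qed.

(** Every x_i^2 is congruent to x_w^2 for a base vertex [w], so all squares can be collected at [w],
    factor by factor. *)
Lemma sq_ideal_normal (w : V) a :
  sq_ideal ('X_[a] - (\prod_(i < #|V|) 'X_i ^+ odd (a i))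
                       * xvar K w ^+ 2 ^+ (\sum_(i < #|V|) (a i)./2)).
Proof.
rewrite mpolyXE_id -prodrXr -big_split /=.
apply: (big_rec2 (fun x y => sq_ideal (x - y))).
  by rewrite subrr; apply: ideal_gen0.
move=> i x y _ xy; apply: ideal_gen_congM xy.
rewrite -{1}[a i]odd_double_half exprD -mul2n exprM -mulrBr.
apply/ideal_genM/ideal_gen_congX/ideal_gen_sub.
by exists (enum_val i), w; rewrite /xvar enum_valK.
Qed.

(** Both monomials have the same normal form: the parities fix its squarefree part, and together
    with the degree they fix the exponent of x_w^2. *)
Lemma sq_ideal_same_parity (w : V) a b :
  same_parity a b -> sq_ideal ('X_[a] - 'X_[b]).
Proof.
move=> /same_parityP[ab_deg ab_odd].
have half_sum (c : 'X_{1..#|V|}) : ((\sum_(i < #|V|) (c i)./2).*2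
                   = mdeg c - \sum_(i < #|V|) odd (c i))%N.
  rewrite mdegE -(eq_bigr _ (fun i _ => odd_double_half (c i))) big_split /=.
  rewrite addKn -mul2n big_distrr; apply: eq_bigr => i _; exact: mul2n.
have Na := sq_ideal_normal w a; have := sq_ideal_normal w b.
have <- : (\sum_(i < #|V|) (a i)./2 = \sum_(i < #|V|) (b i)./2)%N.
  apply: double_inj; rewrite !half_sum ab_deg.
  by congr subn; apply: eq_bigr => i _; rewrite ab_odd.
under eq_bigr do rewrite -ab_odd.
set N := (\prod_(_ < _) _) * _ in Na *.
move=> /(ideal_genM (-1)) /(ideal_genD Na).
by rewrite mulN1r opprB addrA subrK.
Qed.

End SquareIdeal.


(** * The Eulerian ideal and its standard monomials *)

Section EulerianIdeal.
Variables (V : finType) (E : {set {set V}}).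
Implicit Types m : 'X_{1..nedges E}.

Definition vertex_mnm m : 'X_{1..#|V|} :=
  (\sum_(k < nedges E) (\sum_(v in val (enum_val k)) U_(enum_rank v)) *+ m k)%MM.

Lemma vertex_mnmD m1 m2 :
  vertex_mnm (m1 + m2)%MM = (vertex_mnm m1 + vertex_mnm m2)%MM.
Proof.
rewrite /vertex_mnm -big_split; apply: eq_bigr => k _ /=.
by apply/mnmP => i; rewrite !(mulmnE, mnmDE) mulnDr.
Qed.

Definition same_class m1 m2 := same_parity (vertex_mnm m1) (vertex_mnm m2).

Lemma same_classD m1 m2 m :
  same_class m1 m2 -> same_class (m1 + m)%MM (m2 + m)%MM.
Proof. by rewrite /same_class !vertex_mnmD; apply: same_parityD. Qed.

Variable K : fieldType.
Implicit Types p : {mpoly K[nedges E]}.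

Lemma phiX m : phi ('X_[m] : {mpoly K[nedges E]}) = 'X_[vertex_mnm m].
Proof.
rewrite /phi comp_mpolyX -mprodXE; apply: eq_bigr => k _.
by rewrite tnth_mktuple -mpolyXn -mprodXE.
Qed.

(** Since [phi] sends monomials to monomials, a class sum of the image is a sum over the preimage of
    the class. *)
Lemma coef_sum_phi P p :
  coef_sum P (phi p) = coef_sum (fun m => P (vertex_mnm m)) p.
Proof.
rewrite {1}[p]mpolyE /phi raddf_sum /=.
under eq_bigr do rewrite comp_mpolyZ -/(phi _) phiX.
rewrite coef_sum_big /coef_sum [RHS]big_mkcond; apply: eq_bigr => m _.
by rewrite -/(coef_sum _ _) coef_sumX; case: ifP; rewrite ?mulr1 ?mulr0.
Qed.

Lemma coef_sum_eulerian m p :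
  eulerian_ideal p -> coef_sum (same_class m) p = 0.
Proof.
by move=> /(coef_sum_sq_ideal (vertex_mnm m)); rewrite coef_sum_phi.
Qed.

Lemma eulerian_binomial (w : V) m1 m2 :
  same_class m1 m2 -> eulerian_ideal ('X_[m1] - 'X_[m2] : {mpoly K[nedges E]}).
Proof.
rewrite /eulerian_ideal /phi comp_mpolyB -!/(phi _) !phiX.
exact: sq_ideal_same_parity.
Qed.

Lemma eulerian_idealM r p : eulerian_ideal p -> eulerian_ideal (r * p).
Proof. by rewrite /eulerian_ideal /phi rmorphM; apply: ideal_genM. Qed.

Variable e : edge E.

(** Multiples of t_e involve only monomials divisible by t_e, and the hypothesis keeps those out of
    the class of [m]. *)
Lemma coef_sum_eulerian_with m p :
    (forall m', same_class m m' -> m' (enum_rank e) = 0%N) ->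
  eulerian_ideal_with K e p -> coef_sum (same_class m) p = 0.
Proof.
move=> m_e [s [Ss ->]]; elim: s Ss => [|c s IHs] Ss.
  by rewrite big_nil coef_sum0.
rewrite big_cons coef_sumD IHs ?addr0; last first.
  by move=> d ds; apply: Ss; rewrite inE ds orbT.
have [Ic | ->] := Ss c (mem_head _ _).
  exact/coef_sum_eulerian/eulerian_idealM.
rewrite coef_sumME big1_seq // => m' _.
rewrite -mpolyXD coef_sumX; case: (boolP (same_class _ _)) => [/m_e|].
  by rewrite mnmDE mnm1E eqxx addn1.
by rewrite mulr0.
Qed.

Variable prec : rel 'X_{1..nedges E}.
Hypothesis prec_irr : irreflexive prec.
Hypothesis precD : forall m1 m2 m, prec m1 m2 -> prec (m1 + m)%MM (m2 + m)%MM.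

Let I := eulerian_ideal_with K e.

Lemma standard_nlead m q : standard prec I m -> I q -> ~ is_lead prec q m.
Proof. by move=> m_std Iq q_m; apply/m_std/ideal_gen_sub; exists q, m. Qed.

(** The binomial of [m] and [m'] lies in the ideal. If t_e divides [m'], then [m] itself lies in the
    ideal; if [m'] is smaller, then [m] is the leading monomial of the binomial. *)
Lemma standard_same_class (w : V) m m' : standard prec I m -> same_class m m' ->
  m' (enum_rank e) = 0%N /\ ~~ prec m' m.
Proof.
move=> m_std mm'.
have Imm' : I ('X_[m] - 'X_[m']).
  by apply: ideal_gen_sub; left; apply: eulerian_binomial.
split.
  apply/eqP; rewrite -leqn0 leqNgt; apply/negP => m'_gt0.
  have Im : I 'X_[m].
    rewrite -['X_[m]](subrK 'X_[m']); apply: ideal_genD => //.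
    have /submK <- : (U_(enum_rank e) <= m')%MM.
      by apply/mnm_lepP => i; rewrite mnm1E; case: eqP => // <-.
    by rewrite mpolyXD; apply/ideal_genM/ideal_gen_sub; right.
  apply: (standard_nlead m_std Im); split; first by rewrite msuppX mem_head.
  by move=> m1; rewrite msuppX inE => ->.
apply/negP => m'm; apply: (standard_nlead m_std Imm').
have ne : m' != m by apply: contraTneq m'm => ->; rewrite prec_irr.
split=> [|m1].
  by rewrite mcoeff_msupp mcoeffB !mcoeffX eqxx (negPf ne) subr0 oner_neq0.
rewrite mcoeff_msupp mcoeffB !mcoeffX [m == _]eq_sym => m1_supp /negPf m1m.
move: m1_supp; rewrite m1m sub0r oppr_eq0; case: (m' =P m1) => [<- //|].
by rewrite eqxx.
Qed.

(** Otherwise [m] is a multiple of the leading monomial [l] of some [q] in the ideal. The sum of the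
    coefficients of [q] over the class of [l] vanishes, yet only the non-zero coefficient at [l]
    contributes to it. *)
Lemma same_class_standard m :
    (forall m', same_class m m' -> m' (enum_rank e) = 0%N /\ ~~ prec m' m) ->
  standard prec I m.
Proof.
move=> m_min [s [Ss mE]].
have /hasP[c cs c_m] : has (fun c => m \in msupp (c.1 * c.2)) s.
  apply: contraT => /hasPn s_m.
  have : ('X_[m] : {mpoly K[nedges E]})@_m != 0.
    by rewrite mcoeffX eqxx oner_neq0.
  rewrite mE (raddf_sum (mcoeff m)) big1_seq ?eqxx // => c /andP[_ cs].
  exact/memN_msupp_eq0/s_m.
have [q [l [Iq [l_q l_lead] c2E]]] := Ss c cs.
move: c_m; rewrite c2E (perm_mem (msuppMX _ _)) => /mapP[n _ m_ln].
(* The condition on [m] passes to its divisor [l], because multiplication by the cofactor [n]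
   preserves classes and the order. *)
have l_min l' : same_class l l' -> l' (enum_rank e) = 0%N /\ ~~ prec l' l.
  move=> ll'; have [] := m_min (l' + n)%MM.
    by rewrite m_ln; apply: same_classD.
  rewrite mnmDE m_ln => /eqP; rewrite addn_eq0 => /andP[/eqP-> _] nprec.
  by split=> //; apply: contra nprec; apply: precD.
have : coef_sum (same_class l) q = 0.
  by apply: coef_sum_eulerian_with Iq => l' /l_min[].
rewrite /coef_sum big_mkcond (bigD1_seq l) ?msupp_uniq //=.
rewrite [same_class l l]same_parity_refl big_seq_cond big1 ?addr0.
  by apply/eqP; rewrite -mcoeff_msupp.
move=> l' /andP[l'_q l'_l]; case: ifP => // /l_min[_ /negP[]].
exact: l_lead.
Qed.

End EulerianIdeal.

(** * The graded reverse lexicographic order *)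

Section Grevlex.
Variables (V : finType) (E : {set {set V}}) (eps : 'I_(nedges E) -> edge E).
Implicit Types m : 'X_{1..nedges E}.

Lemma grevlexP m1 m2 :
  reflect ((mdeg m1 < mdeg m2)%N \/ mdeg m1 = mdeg m2 /\
    exists2 k : 'I_(nedges E),
      (m2 (enum_rank (eps k)) < m1 (enum_rank (eps k)))%N &
      forall l : 'I_(nedges E), (k < l)%N ->
        m1 (enum_rank (eps l)) = m2 (enum_rank (eps l)))
    (grevlex eps m1 m2).
Proof.
apply: (iffP orP) => -[lt12 | ]; [by left | | by left | ].
  move=> /andP[/eqP eq12 /existsP[k /andP[lt_k /forallP eq_l]]]; right.
  by split=> //; exists k => // l kl; apply/eqP/(implyP (eq_l l)).
move=> [eq12 [k lt_k eq_l]]; right; rewrite eq12 eqxx; apply/existsP; exists k.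
by rewrite lt_k; apply/forallP => l; apply/implyP => kl; apply/eqP/eq_l.
Qed.

Lemma grevlex_irr : irreflexive (grevlex eps).
Proof. by move=> m; apply/negP => /grevlexP[|[_ [k]]]; rewrite ltnn. Qed.

(** When all degrees agree, the larger of the two deciding indices decides the composite
    comparison. *)
Lemma grevlex_trans : transitive (grevlex eps).
Proof.
move=> m2 m1 m3 /grevlexP[lt12|[eq12 [k k12 l12]]].
  move=> /grevlexP[lt23|[eq23 _]]; apply/grevlexP; left.
    exact: ltn_trans lt23.
  by rewrite -eq23.
move=> /grevlexP[lt23|[eq23 [k' k23 l23]]]; apply/grevlexP.
  by left; rewrite eq12.
right; split; first by rewrite eq12.
case: (ltngtP k k') => [kk' | k'k | /val_inj kk'].
- exists k' => [|l k'l]; first by rewrite l12.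
  by rewrite l12 ?l23 //; apply: ltn_trans k'l.
- exists k => [|l kl]; first by rewrite -l23.
  by rewrite l12 ?l23 //; apply: ltn_trans kl.
- subst k'; exists k => [|l kl]; first exact: ltn_trans k12.
  by rewrite l12 ?l23.
Qed.

Lemma grevlexD m1 m2 m :
  grevlex eps m1 m2 -> grevlex eps (m1 + m)%MM (m2 + m)%MM.
Proof.
move=> /grevlexP[lt12|[eq12 [k k12 l12]]]; apply/grevlexP; rewrite !mdegD.
  by left; rewrite ltn_add2r.
right; rewrite eq12; split=> //; exists k; first by rewrite !mnmDE ltn_add2r.
by move=> l kl; rewrite !mnmDE l12.
Qed.

Lemma grevlex_total m1 m2 : bijective eps ->
  mdeg m1 = mdeg m2 -> m1 != m2 -> grevlex eps m1 m2 || grevlex eps m2 m1.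
Proof.
move=> [g epsK gK] eq12 ne12.
pose differ (k : 'I_(nedges E)) :=
  m1 (enum_rank (eps k)) != m2 (enum_rank (eps k)).
have [k0 k0P] : exists k, differ k.
  apply/existsP; apply: contraNT ne12 => /existsPn same12.
  apply/eqP/mnmP => i; have := same12 (g (enum_val i)).
  by rewrite /differ gK enum_valK => /negPn/eqP.
(* The last index at which the exponents differ decides the comparison. *)
have [k kP k_max] := arg_maxnP (fun k : 'I_(nedges E) => val k) k0P.
have l12 (l : 'I_(nedges E)) : (k < l)%N ->
    m1 (enum_rank (eps l)) = m2 (enum_rank (eps l)).
  by move=> kl; apply/eqP; apply: contraLR kl => /k_max; rewrite -leqNgt.
apply/orP; move: kP; rewrite /differ neq_ltn => /orP[lt12|lt21].
  by right; apply/grevlexP; right; split=> //; exists k => // l /l12.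
by left; apply/grevlexP; right; split=> //; exists k => // l /l12.
Qed.

Lemma exists_grevlex_min (P : pred 'X_{1..nedges E}) d m0 :
    (forall m, P m -> mdeg m = d) -> P m0 ->
  exists2 m, P m & forall m', P m' -> ~~ grevlex eps m' m.
Proof.
move=> Pd Pm0; pose bmn := bmultinom (nedges E) d.+1.
have bmnP m : P m -> exists b : bmn, m = b.
  move=> Pm; have md : (mdeg m < d.+1)%N by rewrite (Pd m Pm).
  by exists (BMultinom md).
have [b0 m0E] := bmnP _ Pm0; rewrite m0E in Pm0.
(* Bounded degree leaves finitely many candidates. Passing to a smaller one strictly shrinks its set
   [below], so a candidate with the fewest elements below it is minimal. *)
pose below (b : bmn) := [set b' : bmn | P b' && grevlex eps b' b].
have [b Pb b_min] := @arg_minnP _ b0 (fun b : bmn => P b) (fun b => #|below b|) Pm0.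
exists b => // m' Pm'; have [b' m'E] := bmnP _ Pm'; rewrite m'E in Pm' *.
apply/negP => b'b; have := b_min _ Pm'; rewrite leqNgt => /negP; apply.
apply/proper_card/properP; split.
  by apply/subsetP => c; rewrite !inE => /andP[-> /= /grevlex_trans->].
by exists b'; rewrite !inE ?Pm' ?b'b // grevlex_irr.
Qed.

End Grevlex.

(** * Joins, their minimum cardinalities and monomials *)

Lemma natr_Z2_eq m n : (m%:R == n%:R :> 'Z_2) = (odd m == odd n).
Proof. by rewrite -val_eqE /= !val_Zp_nat //= !modn2; do 2!case: odd. Qed.

Lemma in_symdiff (W : finType) (T1 T2 : {set W}) v :
  (v \in symdiff T1 T2) = (v \in T1) (+) (v \in T2).
Proof. by rewrite !inE; do 2!case: (v \in _). Qed.

Lemma symdiffK (W : finType) (T1 T2 : {set W}) : symdiff (symdiff T1 T2) T2 = T1.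
Proof. by apply/setP => v; rewrite !in_symdiff addbK. Qed.

Section Tjoins.
Variables (V : finType) (E : {set {set V}}).
Implicit Types (m : 'X_{1..nedges E}) (J : {set edge E}) (T : {set V}).

Lemma reindex_edges (R : Type) (idx : R) (op : Monoid.com_law idx)
    (F : 'I_(nedges E) -> R) :
  \big[op/idx]_(k < nedges E) F k = \big[op/idx]_(h : edge E) F (enum_rank h).
Proof. exact/reindex/onW_bij/enum_rank_bij. Qed.

(** Writing degree parity as an exclusive-or sum makes [odd_vertices] additive for symmetric
    difference and allows exchange of summation. *)
Lemma in_odd_vertices J v :
  (v \in odd_vertices J) = \big[addb/false]_(h in J) (v \in val h).
Proof.
rewrite inE -sum1_card (big_morph odd oddD (erefl _)).
rewrite [LHS]big_mkcond [RHS]big_mkcond; apply: eq_bigr => h _.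
by rewrite inE; case: (h \in J); case: (v \in val h).
Qed.

Lemma odd_vertices1 (h : edge E) : odd_vertices [set h] = val h.
Proof. by apply/setP => v; rewrite in_odd_vertices big_set1. Qed.

Lemma odd_vertices_symdiff J1 J2 :
  odd_vertices (symdiff J1 J2) = symdiff (odd_vertices J1) (odd_vertices J2).
Proof.
apply/setP => v; rewrite in_symdiff !in_odd_vertices.
rewrite big_mkcond (big_mkcond (mem J1)) (big_mkcond (mem J2)) -big_split /=.
apply: eq_bigr => h _; rewrite in_symdiff.
by do 2!case: (h \in _); rewrite ?addbb ?addbF.
Qed.

Lemma odd_supportD m1 m2 :
  odd_support (m1 + m2)%MM = symdiff (odd_support m1) (odd_support m2).
Proof. by apply/setP => h; rewrite in_symdiff !inE mnmDE oddD. Qed.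

Lemma odd_supportU (h : edge E) : odd_support U_(enum_rank h)%MM = [set h].
Proof.
apply/setP => h'; rewrite !inE mnm1E oddb eq_sym.
by rewrite (inj_eq enum_rank_inj).
Qed.

Definition theta m := odd_vertices (odd_support m).

Lemma thetaD m1 m2 : theta (m1 + m2)%MM = symdiff (theta m1) (theta m2).
Proof. by rewrite /theta odd_supportD odd_vertices_symdiff. Qed.

Lemma thetaU (h : edge E) : theta U_(enum_rank h)%MM = val h.
Proof. by rewrite /theta odd_supportU odd_vertices1. Qed.

(** The exponent of x_v in the image is the sum of the exponents of the edges at [v]; modulo 2 only
    the edges of [odd_support m] count. *)
Lemma odd_vertex_mnm m v :
  odd (vertex_mnm m (enum_rank v)) = (v \in theta m).
Proof.
rewrite in_odd_vertices big_mkcond /= mnm_sumE (big_morph odd oddD (erefl _)).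
rewrite (reindex_edges) /=; apply: eq_bigr => h _.
rewrite mulmnE enum_rankK oddM inE andbC; case: (odd _) => //=.
rewrite mnm_sumE; under eq_bigr do rewrite mnm1E (inj_eq enum_rank_inj).
case: (boolP (v \in val h)) => vh.
  by rewrite (bigD1 v) //= eqxx big1 // => w /andP[_ /negPf->].
by rewrite big1 // => w wh; case: eqP => // wv; rewrite -wv wh in vh.
Qed.

Lemma mdeg_vertex_mnm m : simple_graph E -> mdeg (vertex_mnm m) = (mdeg m).*2.
Proof.
move=> simpleG; rewrite mdeg_sum -muln2 mdegE big_distrl; apply: eq_bigr => k _ /=.
rewrite mdegMn mdeg_sum (eq_bigr (fun=> 1%N)); last by move=> v _; rewrite mdeg1.
by rewrite sum1_card (simpleG _ (valP (enum_val k))) mulnC.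
Qed.

Lemma same_classE m1 m2 : simple_graph E ->
  same_class m1 m2 = (mdeg m1 == mdeg m2) && (theta m1 == theta m2).
Proof.
move=> simpleG; rewrite /same_class /same_parity !mdeg_vertex_mnm //.
rewrite (inj_eq double_inj); congr andb; apply/forallP/eqP => [odd12|eq12 i].
  by apply/setP => v; rewrite -!odd_vertex_mnm; apply/eqP.
by rewrite -[i]enum_valK !odd_vertex_mnm eq12.
Qed.

(** Handshake argument: both ends of an edge lie in the same component, so each edge contributes 0
    or 2 to the degree sum over a component. *)
Lemma theta_even m : simple_graph E -> theta m \in even_subsets E.
Proof.
move=> simpleG; rewrite inE; apply/forall_inP => C.
have adj_sym : ssrbool.symmetric (adj E).
  by move=> u v; rewrite /adj setUC.
move=> /imsetP[x _ ->]; set C' := [set y in _ | _].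
rewrite -sum1_card (big_morph odd oddD (erefl _)) big_mkcond /=.
rewrite (eq_bigr (fun v => \big[addb/false]_(h in odd_support m)
                             ((v \in C') && (v \in val h)))); last first.
  move=> v _; rewrite inE in_odd_vertices; case: (v \in C').
    by rewrite andbT; case: ifP.
  by rewrite andbF big1.
rewrite exchange_big big1 //= => h _.
have /cards2P[a [b [ab hE]]] : #|val h| == 2 by rewrite (simpleG _ (valP h)).
rewrite hE (bigD1 a) //= (bigD1 b) /=; last by rewrite eq_sym.
rewrite big1 => [|v /andP[va vb]]; last first.
  by rewrite in_set2 (negPf va) (negPf vb) andbF.
have a_b : adj E a b by rewrite /adj -hE; apply: valP.
rewrite !in_set2 !eqxx orbT !andbT addbF !inE /=.
suff -> : connect (adj E) x a = connect (adj E) x b by rewrite addbb.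
apply/idP/idP => /connect_trans; apply; apply: connect1 => //.
by rewrite adj_sym.
Qed.

Lemma tau_le J i T : J \in Tjoins E i T -> (tau E i T <= #|J|)%N.
Proof. by rewrite /tau -minEnat -leEnat => /bigmin_le_cond->. Qed.

Lemma tau_attained i T : Tjoins E i T != set0 ->
  exists2 J, J \in Tjoins E i T & #|J| = tau E i T.
Proof.
case/set0Pn => J0 J0T; rewrite /tau -minEnat.
have [|J JT ->] := eq_bigmin J0 _ (fun J => #|J|) J0T (x := nedges E).
  (* The default value [nedges E] is at least every cardinality, so it cannot undercut the
     minimum. *)
  by move=> J _; rewrite leEnat max_card.
by exists J.
Qed.

(* Each [theta m] is realised by [odd_support m], and adding squares of one
   variable to a squarefree monomial raises its degree by any even number. *)
Lemma theta_mdegP (e : edge E) T d :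
  (exists2 m, theta m = T & mdeg m = d) <->
  Tjoins E d%:R T != set0 /\ (tau E d%:R T <= d)%N.
Proof.
split=> [[m mT md] | [/tau_attained[J JT Jtau] le_d]].
  have card_J : #|odd_support m| = (\sum_(k < nedges E) odd (m k))%N.
    rewrite -sum1_card big_mkcond (reindex_edges) /=.
    by apply: eq_bigr => h _; rewrite inE; case: odd.
  have JT : odd_support m \in Tjoins E d%:R T.
    rewrite inE -/(theta m) mT eqxx natr_Z2_eq card_J -md mdegE.
    rewrite !(big_morph odd oddD (erefl _)).
    by apply/eqP/eq_bigr => k _; rewrite oddb.
  split; first by apply/set0Pn; exists (odd_support m).
  apply: leq_trans (tau_le JT) _; rewrite card_J -md mdegE.
  by apply: leq_sum => k _; case: (m k) => // n; apply: leq_trans (leq_b1 _) _.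
move: JT; rewrite inE natr_Z2_eq => /andP[/eqP JT /eqP odd_Jd].
rewrite -Jtau in le_d.
have [n dE] : exists n, d = (#|J| + n.*2)%N.
  exists (d - #|J|)./2; rewrite halfK oddB // odd_Jd addbb subn0 subnKC //.
pose mJ : 'X_{1..nedges E} := [multinom (enum_val k \in J : nat) | k < nedges E].
have mJ_J : odd_support mJ = J.
  by apply/setP => h; rewrite inE mnmE enum_rankK oddb.
exists (mJ + U_(enum_rank e) *+ n.*2)%MM.
  rewrite -JT thetaD /theta mJ_J; apply/setP => v; rewrite in_symdiff.
  rewrite [odd_support (_ *+ _)%MM](_ : _ = set0); last first.
    by apply/setP => h; rewrite !inE mulmnE oddM odd_double andbF.
  by rewrite [_ \in odd_vertices set0]in_odd_vertices big_set0 addbF.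
rewrite mdegD mdegMn mdeg1 mul1n dE; congr (_ + _)%N.
rewrite mdegE (reindex_edges) -sum1_card [RHS]big_mkcond /=.
by apply: eq_bigr => h _; rewrite mnmE enum_rankK; case: ifP.
Qed.

Lemma tau_natr i T : Tjoins E i T != set0 -> (tau E i T)%:R = i.
Proof.
move=> /tau_attained[J JT <-]; move: JT.
by rewrite inE => /andP[_ /eqP].
Qed.

(** Multiplying a monomial of least degree above (T, i) by t_e gives one above (T + e, i + 1), of
    degree one higher. *)
Lemma tau_symdiff_le (e : edge E) i T : Tjoins E i T != set0 ->
  Tjoins E (i + 1) (symdiff T (val e)) != set0 /\
  (tau E (i + 1)%R (symdiff T (val e)) <= tau E i T + 1)%N.
Proof.
move=> T0; have iE := tau_natr T0; set t := tau E i T in iE *.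
have [|m mT md] := (theta_mdegP e T t).2; first by rewrite iE.
have := (theta_mdegP e (symdiff T (val e)) (t + 1)).1.
rewrite natrD iE; apply; exists (m + U_(enum_rank e))%MM.
  by rewrite thetaD thetaU mT.
by rewrite mdegD mdeg1 md.
Qed.

(** Multiplication and division by t_e exchange the monomials of degree d - 1 above T + e with the
    monomials of degree d above T that t_e divides. *)
Lemma tau_symdiff_lt (e : edge E) d T : Tjoins E d%:R T != set0 ->
  (tau E (d%:R + 1)%R (symdiff T (val e)) < d)%N <->
  exists2 m, theta m = T /\ mdeg m = d & (0 < m (enum_rank e))%N.
Proof.
(* Modulo 2 the index d + 1 is the parity of the degree d - 1 left after division by t_e. *)
have natr_pred n : n.+1%:R + 1 = n%:R :> 'Z_2.
  by apply/eqP; rewrite -[1]/(1%:R) -natrD natr_Z2_eq addn1 /= negbK.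
move=> /(tau_symdiff_le e)[T'0 _]; split.
  case: d T'0 => // d; rewrite ltnS natr_pred => T'0 le_d.
  have [|m mT md] := (theta_mdegP e (symdiff T (val e)) d).2; first by split.
  exists (m + U_(enum_rank e))%MM; last by rewrite mnmDE mnm1E eqxx addn1.
  by rewrite thetaD thetaU mT symdiffK mdegD mdeg1 md addn1.
move=> [m [mT md] m_e].
have /submK mE : (U_(enum_rank e) <= m)%MM.
  by apply/mnm_lepP => i; rewrite mnm1E; case: eqP => // <-.
rewrite -mE thetaD thetaU in mT; rewrite -mE mdegD mdeg1 addn1 in md.
rewrite -md ltnS natr_pred -mT symdiffK; set m' := (m - _)%MM.
by apply: ((theta_mdegP e _ _).1 _).2; exists m'.
Qed.

End Tjoins.

(** * Injectivity and image of [vartheta] *)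

Theorem theorem4p9 (K : fieldType) (V : finType) (E : {set {set V}})
    (simpleG : simple_graph E) (no_isolated : no_isolated_vertex E)
    (E_neq0 : E != set0) (e : edge E)
    (eps : 'I_(nedges E) -> edge E) (eps_bij : bijective eps)
    (eps_last : forall k : 'I_(nedges E), k.+1 = nedges E -> eps k = e) :
  let B := standard (grevlex eps) (eulerian_ideal_with K e) in
  (forall m1 m2, B m1 -> B m2 -> vartheta m1 = vartheta m2 -> m1 = m2) /\
  (forall (T : {set V}) (i : 'Z_2),
     (exists2 m, B m & vartheta m = (T, i)) <->
     [/\ T \in even_subsets E, Tjoins E i T != set0 &
         tau E (i + 1) (symdiff T (val e)) = (tau E i T + 1)%N]).
Proof.
move=> B.
have [w _] : exists w, w \in val e.
  by apply/set0Pn; rewrite -card_gt0 (simpleG _ (valP e)).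
have BP m : B m <-> forall m', theta m' = theta m /\ mdeg m' = mdeg m ->
    m' (enum_rank e) = 0%N /\ ~~ grevlex eps m' m.
  split=> [Bm m' [thm' dm']|m_min].
    apply: (standard_same_class (@grevlex_irr _ _ eps) w Bm).
    by rewrite same_classE // thm' dm' !eqxx.
  apply: same_class_standard => [|m']; first exact: grevlexD.
  by rewrite same_classE // => /andP[/eqP dm' /eqP thm']; apply: m_min.
have B_deg m : B m -> let i := (mdeg m)%:R in
    [/\ Tjoins E i (theta m) != set0, tau E i (theta m) = mdeg m &
        tau E (i + 1) (symdiff (theta m) (val e)) = (mdeg m + 1)%N].
  move=> /BP m_min i.
  have [|T0 le_tau] := (theta_mdegP e (theta m) (mdeg m)).1; first by exists m.
  have [T'0 le_tau'] := tau_symdiff_le e T0.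
  (* A smaller value would put a multiple of t_e into the class of [m]. *)
  have ge_tau' : (mdeg m <= tau E (i + 1)%R (symdiff (theta m) (val e)))%N.
    rewrite leqNgt; apply/negP => /(tau_symdiff_lt e T0)[m' /m_min[-> _]].
    by rewrite ltnn.
  (* With t and t' the two minima and d the degree, t <= d <= t' <= t + 1. As t has the parity of d
     and t' the opposite one, t = d and t' = d + 1. *)
  have odd_tau : odd (tau E i (theta m)) = odd (mdeg m).
    by apply/eqP; rewrite -natr_Z2_eq tau_natr.
  have odd_tau' : odd (tau E (i + 1) (symdiff (theta m) (val e)))
                  = ~~ odd (mdeg m).
    apply/eqP; rewrite -[~~ _]/(odd (mdeg m).+1) -natr_Z2_eq -natr1.
    by apply/eqP; apply: tau_natr.
  move: le_tau le_tau' ge_tau' odd_tau odd_tau'; rewrite -/i.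
  move: (tau E i _) (tau E (i + 1) _) => t t' le_t le_t' ge_t' odd_t odd_t'.
  by split=> //; lia.
split=> [m1 m2 B1 B2 [th12 d12]|T i].
  have [_ deg1 _] := B_deg _ B1; have [_ deg2 _] := B_deg _ B2.
  (* Equal parity of degrees becomes equality, since both degrees are the same minimum. The
     monomials then share a class, in which two distinct ones cannot both be minimal. *)
  have {}d12 : mdeg m1 = mdeg m2.
    by rewrite -deg1 -deg2 /theta th12 d12.
  apply/eqP; apply: contraT => /(grevlex_total eps_bij d12) /orP[lt12|lt21].
    by have [_ /negP] := (BP m2).1 B2 m1 (conj th12 d12).
  by have [_ /negP] := (BP m1).1 B1 m2 (conj (esym th12) (esym d12)).
split=> [[m Bm [<- <-]]|[_ T0 tau'E]].
  have [T0 tauE tau'E] := B_deg m Bm.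
  by split=> //; [exact: theta_even | rewrite tau'E tauE].
have iE := tau_natr T0; set t := tau E i T in iE tau'E *.
have [|m0 m0T dm0] := (theta_mdegP e T t).2; first by rewrite iE.
(* The preimage of (T, i) is the smallest monomial in the class of T and the least possible degree
   [t]. *)
have [||m /andP[/eqP dm /eqP mT] m_min] := @exists_grevlex_min _ _ eps
    (fun m => (mdeg m == t) && (theta m == T)) t m0.
- by move=> m /andP[/eqP].
- by rewrite dm0 m0T !eqxx.
exists m; last by rewrite /vartheta -/(theta m) mT dm iE.
apply/BP => m'; rewrite mT dm => -[m'T dm']; split; last first.
  by apply: m_min; rewrite m'T dm' !eqxx.
apply/eqP; rewrite -leqn0 leqNgt; apply/negP => m'_e.
have T0t : Tjoins E t%:R T != set0 by rewrite iE.
(* A class member divisible by t_e would force the minimum for T + e below [t], whereas it equals t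
   + 1. *)
have := (tau_symdiff_lt e T0t).2; rewrite iE tau'E ltnNge leq_addr.
by move=> lt_t; suff: false by []; apply: lt_t; exists m'.
Qed.
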